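(* Let $\mathcal V\subset\mathbb R^2$ be open and convex, and let $\partial_tU+\partial_xf(U)=0$ be a $2\times2$ system of conservation laws with smooth flux $f:\mathcal V\to\mathbb R^2$ that has global shock curves and verifies the (global) Liu entropy condition. Let the system be endowed with a strictly convex entropy $\eta:\mathcal V\to\mathbb R$ with associated entropy-flux $q:\mathcal V\to\mathbb R$. Then the set $\mathcal K_{f,\eta,q}$ does not contain rank-one connections, i.e. there are no $A,B\in\mathcal K_{f,\eta,q}$ such that $A-B$ has rank one.
   Context: Entropy/entropy-flux pair: smooth $\eta,q:\mathcal V\to\mathbb R$ with $\nabla q=\nabla\eta\,Df$. With $f=(f_1,f_2)$, $U=(u_1,u_2)$, $$G(U)=\begin{bmatrix}u_1&f_1(U)\\ u_2&f_2(U)\\ \eta(U)&q(U)\end{bmatrix},\qquad \mathcal K_{f,\eta,q}=\{G(U):U\in\mathcal V\}\subset\mathbb R^{3\times2}.$$ Hugoniot locus at $U_0\in\mathcal V$: $H(U_0)=\{U\in\mathcal V:\exists\sigma\in\mathbb R,\ \sigma(U-U_0)=f(U)-f(U_0)\}$. Global shock curves: for each $U_0\in\mathcal V$, $H(U_0)$ is the union of two smooth curves $S^1_{U_0}$ and $S^2_{U_0}$, whose union cuts $\mathcal V$ into four connected pieces. The curves admit smooth parameterizations $s\mapsto S^k_{U_0}(s)$ defined on $\mathbb R$, with $S^1_{U_0}(0)=S^2_{U_0}(0)=U_0$, and such that $(U_0,s)\mapsto S^k_{U_0}(s)$ is continuous ($k=1,2$). There are also smooth parameterizations $s\mapsto\sigma^k_{U_0}(s)$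 of the shock speed with $\sigma^k_{U_0}(s)(S^k_{U_0}(s)-U_0)=f(S^k_{U_0}(s))-f(U_0)$ for $k=1,2$. Liu entropy condition: $\frac{d}{ds}\sigma^k_{U_0}(s)\neq0$ for $k=1,2$, all $U_0\in\mathcal V$ and all $s\neq0$. *)

(* Defs.v *)
From HB Require Import structures.
From mathcomp Require Export all_boot all_order all_algebra.
From mathcomp Require Export all_classical all_reals all_analysis.

Set Implicit Arguments.
Unset Strict Implicit.
Unset Printing Implicit Defensive.

Export Order.TTheory GRing.Theory Num.Theory.
Export numFieldNormedType.Exports.

Local Open Scope classical_set_scope.
Local Open Scope ring_scope.

(* C^oo on an open set A of a finite-dimensional space: every iterated
   directional derivative D_{v1} ... D_{vn} f is (Frechet) differentiable, hence
   continuous, at every point of A.  As A is open, the values of f outside A are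
   irrelevant. *)
Definition smooth_on (R : realType) (E F : normedModType R)
    (A : set E) (f : E -> F) : Prop :=
  forall (vs : seq E) (x : E), A x ->
    differentiable (foldr (fun v g => 'D_v g) f vs) x.

Definition strictly_convex_on (R : realType) (E : lmodType R)
    (A : set E) (g : E -> R) : Prop :=
  forall (x y : E) (t : R), A x -> A y -> x != y -> 0 < t < 1 ->
    g (t *: x + (1 - t) *: y) < t * g x + (1 - t) * g y.

Section Systems.
Variable R : realType.

(* States U = (u_1, u_2), and the values of the flux, are column vectors. *)
Notation state := 'cV[R]_2.

Definition grad (g : state -> R) (U : state) : 'rV[R]_2 :=
  \row_j 'D_(delta_mx j 0) g U.

Definition Dmx (f : state -> state) (U : state) : 'M[R]_2 :=
  \matrix_(i, j) 'D_(delta_mx j 0) (fun W => f W i 0) U.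

Definition entropy_pair (V : set state) (f : state -> state)
    (eta q : state -> R) : Prop :=
  [/\ smooth_on V eta, smooth_on V q &
      forall U, V U -> grad q U = grad eta U *m Dmx f U].

Definition Gmx (f : state -> state) (eta q : state -> R) (U : state) :
    'M[R]_(3, 2) :=
  row_mx (col_mx U (eta U)%:M) (col_mx (f U) (q U)%:M).

Definition Kset (V : set state) (f : state -> state) (eta q : state -> R) :
    set 'M[R]_(3, 2) :=
  Gmx f eta q @` V.

Definition hugoniot (V : set state) (f : state -> state) (U0 : state) :
    set state :=
  [set U | V U /\ exists sigma : R, sigma *: (U - U0) = f U - f U0].

(* The index k : 'I_2 selects the shock family, Sh k U0 s is S^k_{U0}(s) and
   sigma k U0 s is the shock speed sigma^k_{U0}(s); both are constrained only
   for U0 in V.  The curve S^k_{U0} as a set is range (Sh k U0). *)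
Record global_shock_curves (V : set state) (f : state -> state)
    (Sh : 'I_2 -> state -> R -> state) (sigma : 'I_2 -> state -> R -> R) :
    Prop := GlobalShockCurves {
  shock_locus : forall U0, V U0 ->
    hugoniot V f U0 = \bigcup_k range (Sh k U0);
  shock_pieces : forall U0, V U0 ->
    let A := V `\` \bigcup_k range (Sh k U0) in
    (connected_component A @` A #= `I_4)%card;
  shock_smooth : forall k U0, V U0 -> smooth_on [set: R] (Sh k U0);
  shock_start : forall k U0, V U0 -> Sh k U0 0 = U0;
  shock_continuous : forall k,
    {within V `*` [set: R], continuous (fun p => Sh k p.1 p.2)};
  speed_smooth : forall k U0, V U0 -> smooth_on [set: R] (sigma k U0);
  rankine_hugoniot : forall k U0 (s : R), V U0 ->
    sigma k U0 s *: (Sh k U0 s - U0) = f (Sh k U0 s) - f U0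
}.

Definition liu_condition (V : set state) (sigma : 'I_2 -> state -> R -> R) :
    Prop :=
  forall k U0 (s : R), V U0 -> s != 0 -> derive1 (sigma k U0) s != 0.

End Systems.

(* Main.v *)
Require Import Defs.
From mathcomp Require Import ring lra.
Local Open Scope classical_set_scope.
Local Open Scope ring_scope.

(** A rank-one connection between the points of the constitutive set over U
    and U0 says that U is joined to U0 by a shock that satisfies the
    Rankine-Hugoniot condition not only for U but also for the entropy:
    f U - f U0 = a (U - U0) and q U - q U0 = a (eta U - eta U0) for one speed a
    ([rank1_Gmx_sub]).  So U lies on a shock curve S issued from U0, say
    U = S s, and a = c s for the shock speed c, while the shock at parameter s
    neither creates nor destroys entropy.  The proof shows that the entropy
    balance across a nontrivial shock never vanishes.

    Let E t = q (S t) - c t (eta (S t) - eta U0).  Differentiating the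
    Rankine-Hugoniot relation along S gives (Df - c) S' = c' (S - U0), and with
    the compatibility grad q = grad eta Df the terms in S' cancel in E'
    ([entropy_dissipation_derive]):
      E' = c' h, with h = eta U0 - eta (S t) - grad eta (S t) (U0 - S t).
    Strict convexity makes the relative entropy h nonnegative, and positive
    unless S t = U0 ([strictly_convex_derive_lt]).  The Liu condition makes c'
    of one sign between 0 and s, hence E is monotone there.  As E takes the
    same value q U0 at 0 and at s, it is constant between them, so h vanishes
    ([eq_ends_derive_eq0]), that is S t = U0; by continuity U = S s = U0, and
    the connection is trivial. *)

Lemma convex_set_comb {R : realType} {E : lmodType R} {A : set E}
    {x y : E} {t : R} :
  convex_set A -> A x -> A y -> 0 < t < 1 -> A (t *: x + (1 - t) *: y).
Proof.
move=> cA Ax Ay /andP[/ltW t0 /ltW t1].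
by have := cA x y (Itv01 t0 t1) (mem_set Ax) (mem_set Ay) => /set_mem.
Qed.

(** Difference quotients of a convex function along a segment increase, so the
    one-sided limit at the origin is at most the full increment.  This limit
    loses strictness; it is recovered by applying the weak bound at the
    midpoint, where strict convexity beats half of the increment. *)
Lemma strictly_convex_derive_lt {R : realType} {E : normedModType R}
    {A : set E} {g : E -> R} {x y : E} :
  convex_set A -> strictly_convex_on A g -> A x -> A y ->
  differentiable g x -> x != y -> 'D_(y - x) g x < g y - g x.
Proof.
move=> cA gc Ax Ay dg xy.
have weak z : A z -> x != z -> 'D_(z - x) g x <= g z - g x.
  move=> Az xz.
  have cg : derivable g x (z - x) by exact: diff_derivable.
  rewrite /derive cvg_at_rightE//; apply: limr_le.
    rewrite -(cvg_at_rightE (fun h : R => h^-1 *: ((g \o shift x) _ - g x)))//.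
    apply: cvg_trans cg; apply: cvg_app.
    move=> B [e e0 Be]; exists e => // h he h0; apply: Be => //.
    exact/lt0r_neq0.
  near=> h.
  have h0 : 0 < h by near: h; exact: nbhs_right_gt.
  have h1 : h < 1 by near: h; exact: nbhs_right_lt.
  have := gc z x h Az Ax; rewrite eq_sym xz h0 h1 => /(_ isT isT).
  rewrite /= /shift/= -[h^-1 *: _]/(h^-1 * _) ler_pdivrMl//.
  have -> : h *: (z - x) + x = h *: z + (1 - h) *: x.
    by rewrite scalerBr scalerBl scale1r addrAC addrA.
  by move=> /ltW; lra.
have half : 0 < (2^-1 : R) < 1 by lra.
have Am := convex_set_comb cA Ay Ax half.
have mE : 2^-1 *: y + (1 - 2^-1) *: x - x = 2^-1 *: (y - x).
  by rewrite scalerBl scale1r scalerBr -addrA addrAC subrr add0r.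
have xm : x != 2^-1 *: y + (1 - 2^-1) *: x.
  by rewrite eq_sym -subr_eq0 mE scaler_eq0 invr_eq0 pnatr_eq0 subr_eq0/= eq_sym.
have dgE : 'D_(2^-1 *: (y - x)) g x = 2^-1 * 'D_(y - x) g x.
  by rewrite !(deriveE _ dg) linearZ.
have := weak _ Am xm; rewrite mE dgE.
have := gc y x 2^-1 Ay Ax; rewrite eq_sym xy half => /(_ isT isT).
lra.
Unshelve. all: by end_near. Qed.

(** A continuous c without zeros inside ]a, b[ has one sign there, so E, whose
    derivative is c h with h nonnegative, is monotone on [a, b]; having the same
    value at both ends, it is constant, and c h vanishes. *)
Lemma eq_ends_derive_eq0 {R : realType} {a b : R} {E c h : R -> R} :
  a < b -> (forall t : R, is_derive t (1 : R) E (c t * h t)) -> continuous c ->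
  (forall t, t \in `]a, b[ -> c t != 0) -> (forall t, 0 <= h t) ->
  E a = E b -> forall t, t \in `]a, b[ -> h t = 0.
Proof.
move=> ab.
wlog cm0 : E c / 0 < c ((a + b) / 2) => [hwlog dE cc cn0 h0 Eab|].
  have mab : (a + b) / 2 \in `]a, b[ by rewrite in_itv/=; lra.
  have := cn0 _ mab; rewrite neq_lt => /orP[cm|cm]; last exact: (hwlog E c).
  apply: (hwlog (- E) (- c)) => //.
  - by rewrite oppr_gt0.
  - by move=> t; rewrite mulNr; apply: is_deriveN.
  - by move=> t; apply: continuousN; exact: cc.
  - by move=> t tab; rewrite oppr_eq0 cn0.
  - by rewrite !fctE Eab.
move=> dE cc cn0 h0 Eab t tab.
have c_gt0 u : u \in `]a, b[ -> 0 < c u.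
  move=> uab; rewrite ltNge; apply/negP => cu0.
  have sub (x y z : R) : x \in `]a, b[ -> y \in `]a, b[ -> z \in `[x, y] ->
      z \in `]a, b[ by rewrite !in_itv/=; lra.
  have mab : (a + b) / 2 \in `]a, b[ by rewrite in_itv/=; lra.
  have cw (A : set R) : {within A, continuous c}.
    by apply: continuous_subspaceT => ?; exact: cc.
  have [um|/ltW mu] := leP u ((a + b) / 2).
  - have [] := IVT (v := 0) um (cw _).
      by rewrite ge_min cu0 le_max (ltW cm0) orbT.
    by move=> w /(sub _ _ _ uab mab)/cn0/eqP.
  - have [] := IVT (v := 0) mu (cw _).
      by rewrite ge_min cu0 le_max (ltW cm0) !orbT.
    by move=> w /(sub _ _ _ mab uab)/cn0/eqP.
have Emono x y : a <= x -> x <= y -> y <= b -> E x <= E y.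
  apply: ger0_derive1_ndecr.
  - by move=> u _; exact: ex_derive.
  - by move=> u uab; rewrite derive1E derive_val mulr_ge0// ltW// c_gt0.
  - apply: derivable_within_continuous => u _; exact: ex_derive.
have Ec u : u \in `]a, b[ -> E u <= E t.
  move: tab; rewrite !in_itv/= => /andP[/ltW ta /ltW tb] /andP[/ltW ua /ltW ub].
  by rewrite (le_trans (Emono _ _ ua ub (lexx b)))// -Eab Emono.
(* E being constant, t is an interior maximum. *)
have dt0 : is_derive t 1 E 0.
  by apply: (derive1_at_max (ltW ab) _ tab Ec) => u _; exact: ex_derive.
have := @derive_val _ _ _ _ _ _ _ dt0; rewrite (@derive_val _ _ _ _ _ _ _ (dE t)).
by move=> /eqP; rewrite mulf_eq0 (negPf (cn0 _ tab)) => /eqP.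
Qed.

Lemma cst_itvoo_ends {R : realType} {W : normedModType R} {S : R -> W}
    {a b : R} {w} :
  a < b -> continuous S -> (forall t, t \in `]a, b[ -> S t = w) ->
  S a = w /\ S b = w.
Proof.
move=> ab cS Sw; split.
- apply: (@cvg_unique _ _ (S x @[x --> a^'+])) => //.
    by apply: cvg_at_right_filter; exact: cS.
  apply: cvg_near_cst; near=> t; apply: Sw; rewrite in_itv/=; apply/andP; split.
    by near: t; exact: nbhs_right_gt.
  by near: t; exact: nbhs_right_lt.
- apply: (@cvg_unique _ _ (S x @[x --> b^'-])) => //.
    by apply: cvg_at_left_filter; exact: cS.
  apply: cvg_near_cst; near=> t; apply: Sw; rewrite in_itv/=; apply/andP; split.
    by near: t; exact: nbhs_left_gt.
  by near: t; exact: nbhs_left_lt.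
Unshelve. all: by end_near. Qed.

Lemma rank1_row_mx {F : fieldType} {m : nat} {c d : 'cV[F]_m} :
  \rank (row_mx c d) = 1%N -> c != 0 -> exists a : F, d = a *: c.
Proof.
move=> rk c0.
have rkT : \rank (col_mx c^T d^T) = 1%N by rewrite -tr_row_mx mxrank_tr.
have sc : (c^T <= col_mx c^T d^T)%MS by rewrite -addsmxE addsmxSl.
have rc : \rank c^T = 1%N by rewrite rank_rV -trmx0 (inj_eq trmx_inj) c0.
have := mxrank_leqif_sup sc; rewrite rc rkT => -[_ /esym].
rewrite eqxx -addsmxE addsmx_sub => /andP[_ /sub_rVP[a da]].
by exists a; apply: trmx_inj; rewrite da linearZ.
Qed.

Lemma is_derive_curve {R : realType} {E W : normedModType R} {g : E -> W}
    {S : R -> E} {t : R} :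
  differentiable S t -> differentiable g (S t) ->
  is_derive t 1 (g \o S) ('D_('D_1 S t) g (S t)).
Proof.
move=> dS dg; have dgS := differentiable_comp dS dg.
apply: DeriveDef; first exact/diff_derivable.
by rewrite (deriveE _ dgS) diff_comp//= (deriveE _ dg) (deriveE _ dS).
Qed.

Lemma derive_grad {R : realType} {g : 'cV[R]_2 -> R} {U : 'cV[R]_2} w :
  differentiable g U -> 'D_w g U = (grad g U *m w) 0 0.
Proof.
move=> dg; rewrite deriveE// {1}[w]matrix_sum_delta linear_sum mxE.
apply: eq_bigr => j _; rewrite big_ord1 linearZ/= mxE deriveE//.
by rewrite -[_ *: _]/(_ * _) mulrC.
Qed.

Lemma derive_Dmx {R : realType} {f : 'cV[R]_2 -> 'cV[R]_2} {U : 'cV[R]_2} w i :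
  differentiable f U -> 'D_w (fun W => f W i 0) U = (Dmx f U *m w) i 0.
Proof.
move=> df; rewrite derive_grad.
  by rewrite !mxE; apply: eq_bigr => j _; rewrite !mxE.
exact: (differentiable_comp df (differentiable_coord _ _ _)).
Qed.

Lemma is_derive_entry {R : realType} {m n : nat} {S : R -> 'M[R]_(m, n)}
    {t : R} i j :
  differentiable S t -> is_derive t 1 (fun s => S s i j) ('D_1 S t i j).
Proof.
move=> dS; have vS : derivable S t 1 by exact: diff_derivable.
by apply: DeriveDef; [exact: ((derivable_mxP _ _ _).1 vS)|rewrite derive_mx// mxE].
Qed.

(** The product rule, entry by entry, on the Rankine-Hugoniot relation.  It
    expresses Df S', which the derivative of q along the curve involves. *)
Lemma rankine_hugoniot_derive {R : realType} {f : 'cV[R]_2 -> 'cV[R]_2}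
    {S : R -> 'cV[R]_2} {c : R -> R} {U0 : 'cV[R]_2} {t : R} :
  differentiable S t -> derivable c t 1 -> differentiable f (S t) ->
  (forall s, c s *: (S s - U0) = f (S s) - f U0) ->
  Dmx f (S t) *m 'D_1 S t = 'D_1 c t *: (S t - U0) + c t *: 'D_1 S t.
Proof.
move=> dS dc df RH; apply/matrixP => i j; rewrite ord1 {j} -(derive_Dmx _ _ df).
have dfi : differentiable (fun W => f W i 0) (S t).
  exact: (differentiable_comp df (differentiable_coord _ _ _)).
have fS := is_derive_curve dS dfi.
have cS : is_derive t 1 (cst (f U0 i 0) + c * ((fun s => S s i 0) - cst (U0 i 0)))
    (0 + (c t *: ('D_1 S t i 0 - 0) + (S t i 0 - U0 i 0) *: 'D_1 c t)).
  apply: is_deriveD; apply: is_deriveM; first exact: derivableP.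
  by apply: is_deriveB; exact: is_derive_entry.
have fE : (fun W => f W i 0) \o S =
    cst (f U0 i 0) + c * ((fun s => S s i 0) - cst (U0 i 0)).
  apply/funext => s; have := congr1 (fun M : 'cV[R]_2 => M i 0) (RH s).
  by rewrite !fctE/= !mxE => ->; ring.
rewrite -(@derive_val _ _ _ _ _ _ _ fS) fE (@derive_val _ _ _ _ _ _ _ cS) !mxE.
by rewrite -![_ *: _]/(_ * _); ring.
Qed.

(** The differentiated Rankine-Hugoniot relation turns grad q S', which equals
    grad eta Df S', into c' grad eta (S - U0) + c grad eta S'; the last term
    cancels against the derivative of c eta.  What remains is c' times the
    entropy of U0 relative to S t, the gap between eta and its tangent plane
    at S t. *)
Lemma entropy_dissipation_derive {R : realType} {V : set 'cV[R]_2}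
    {f : 'cV[R]_2 -> 'cV[R]_2} {eta q : 'cV[R]_2 -> R}
    {S : R -> 'cV[R]_2} {c : R -> R} {U0 : 'cV[R]_2} {t : R} :
  smooth_on V f -> entropy_pair V f eta q -> V (S t) ->
  differentiable S t -> derivable c t 1 ->
  (forall s, c s *: (S s - U0) = f (S s) - f U0) ->
  is_derive t 1 (fun s => q (S s) - c s * (eta (S s) - eta U0))
    ('D_1 c t * (eta U0 - eta (S t) - 'D_(U0 - S t) eta (S t))).
Proof.
move=> fV [etaV qV qeta] VS dS dc RH.
have deta := etaV [::] _ VS; have dq := qV [::] _ VS; have df := fV [::] _ VS.
rewrite /= in deta dq df.
have D : is_derive t 1 ((q \o S) - c * ((eta \o S) - cst (eta U0)))
    ('D_('D_1 S t) q (S t) - (c t *: ('D_('D_1 S t) eta (S t) - 0) +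
       (eta (S t) - eta U0) *: 'D_1 c t)).
  apply: is_deriveB; first exact: is_derive_curve.
  apply: is_deriveM; first exact: derivableP.
  by apply: is_deriveB; exact: is_derive_curve.
apply: (is_derive_eq D).
rewrite (derive_grad _ dq) (qeta _ VS) -mulmxA (rankine_hugoniot_derive dS dc df RH).
rewrite !(derive_grad _ deta) -[U0 - S t]opprB mulmxN mulmxDr -!scalemxAr.
rewrite !mxE -![_ *: _]/(_ * _); ring.
Qed.

(** Since U - U0 is nonzero, the first column of the rank-one difference is
    nonzero, so the second is a multiple of it.  The factor is a speed shared
    by the two jump conditions. *)
Lemma rank1_Gmx_sub {R : realType} {f : 'cV[R]_2 -> 'cV[R]_2}
    {eta q : 'cV[R]_2 -> R} {U U0 : 'cV[R]_2} :
  U != U0 -> \rank (Gmx f eta q U - Gmx f eta q U0) = 1%N ->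
  exists a, a *: (U - U0) = f U - f U0 /\ a * (eta U - eta U0) = q U - q U0.
Proof.
move=> UU0.
have -> : Gmx f eta q U - Gmx f eta q U0 =
    row_mx (col_mx U (eta U)%:M - col_mx U0 (eta U0)%:M)
           (col_mx (f U) (q U)%:M - col_mx (f U0) (q U0)%:M).
  by rewrite -add_row_mx -opp_row_mx.
rewrite !opp_col_mx !add_col_mx => /(@rank1_row_mx _ (2 + 1))[].
  by rewrite col_mx_eq0 subr_eq0 negb_and UU0.
move=> a; rewrite scale_col_mx => /eq_col_mx[-> qa]; exists a; split=> //.
by move/matrixP/(_ 0 0): qa; rewrite !mxE eqxx !mulr1n.
Qed.

Theorem proposition1p5 (R : realType) (V : set 'cV[R]_2)
    (f : 'cV[R]_2 -> 'cV[R]_2) (eta q : 'cV[R]_2 -> R)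
    (Sh : 'I_2 -> 'cV[R]_2 -> R -> 'cV[R]_2)
    (sigma : 'I_2 -> 'cV[R]_2 -> R -> R)
    (V_open : open V) (V_convex : convex_set V)
    (f_smooth : smooth_on V f)
    (f_shocks : global_shock_curves V f Sh sigma)
    (f_liu : liu_condition V sigma)
    (eta_q : entropy_pair V f eta q)
    (eta_convex : strictly_convex_on V eta) :
  ~ (exists A B : 'M[R]_(3, 2),
       [/\ Kset V f eta q A, Kset V f eta q B & \rank (A - B) = 1%N]).
Proof.
case=> _ [_ [[U VU <-] [U0 VU0 <-] rk1]].
have UU0 : U != U0 by apply: contra_eq_neq rk1 => ->; rewrite subrr mxrank0.
have [a [fa qa]] := rank1_Gmx_sub UU0 rk1.
have : hugoniot V f U0 U by split=> //; exists a.
rewrite (shock_locus f_shocks VU0) => -[k _ [s _ SsU]].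
have S0 := shock_start f_shocks k VU0.
have RH t := rankine_hugoniot f_shocks k t VU0.
have S_smooth := shock_smooth f_shocks k VU0.
have c_smooth := speed_smooth f_shocks k VU0.
have c_liu t : t != 0 -> 'D_1 (sigma k U0) t != 0.
  by rewrite -derive1E; exact: f_liu.
have VS t : V (Sh k U0 t).
  have : (\bigcup_k range (Sh k U0)) (Sh k U0 t) by exists k => //; exists t.
  by rewrite -(shock_locus f_shocks VU0) => -[].
move: (Sh k U0) (sigma k U0) S0 RH S_smooth c_smooth c_liu VS SsU => S c.
move=> S0 RH S_smooth c_smooth c_liu VS SsU.
have s_neq0 : s != 0.
  by apply: contra_neq UU0 => s0; rewrite -SsU s0 S0.
(* As U differs from U0, the jump of f determines the speed. *)
have csa : c s = a.
  have /eqP := RH s; rewrite SsU -fa -subr_eq0 -scalerBl scaler_eq0.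
  by rewrite [U - _ == _]subr_eq0 (negPf UU0) orbF subr_eq0 => /eqP.
have dS t : differentiable S t by exact: (S_smooth [::]).
have dc t : derivable c t 1 by apply: diff_derivable; exact: (c_smooth [::]).
have c'_cont : continuous ('D_1 c).
  by move=> t; apply: differentiable_continuous; exact: (c_smooth [:: 1]).
have S_cont : continuous S by move=> t; exact: differentiable_continuous.
pose E t := q (S t) - c t * (eta (S t) - eta U0).
pose h t := eta U0 - eta (S t) - 'D_(U0 - S t) eta (S t).
have deta t : differentiable eta (S t).
  by case: eta_q => etaV _ _; exact: (etaV [::] _ (VS t)).
have h_gt0 t : S t != U0 -> 0 < h t.
  move=> SU0; rewrite subr_gt0.
  exact: (strictly_convex_derive_lt V_convex eta_convex (VS t) VU0 (deta t) SU0).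
have h_ge0 t : 0 <= h t.
  have [SU0|/h_gt0/ltW//] := eqVneq (S t) U0.
  by rewrite /h SU0 !subrr (deriveE _ _) -?SU0// linear0 subr0.
have E0s : E 0 = E s.
  by rewrite /E S0 SsU csa subrr mulr0 subr0 qa; ring.
(* Stated for an arbitrary interval avoiding 0, as s may be on either side. *)
have endsU0 (l r : R) : l < r -> (forall t, t \in `]l, r[ -> t != 0) -> E l = E r ->
    S l = U0 /\ S r = U0.
  move=> lr n0 Elr; apply: (cst_itvoo_ends lr S_cont) => t tlr.
  have dE u := entropy_dissipation_derive f_smooth eta_q (VS u) (dS u) (dc u) RH.
  have ht0 : h t = 0.
    apply: (eq_ends_derive_eq0 lr dE c'_cont _ h_ge0 Elr _ tlr) => u /n0.
    exact: c_liu.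
  by apply/eqP; apply: contraT => /h_gt0; rewrite ht0 ltxx.
have SsU0 : S s = U0.
  have [s_lt0|s_gt0|/esym/eqP] := ltgtP s 0; last by rewrite eq_sym (negPf s_neq0).
  - by case: (endsU0 s 0) => // t; rewrite in_itv/= => /andP[_ /lt_eqF->].
  - by case: (endsU0 0 s) => // t; rewrite in_itv/= => /andP[/gt_eqF->].
by move: UU0; rewrite -SsU SsU0 eqxx.
Qed.
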